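(* Let $f\colon U\to\mathbb{R}$ be bounded below on $U$, let a sequence $\{x_n\}$ be generated by the method of codifferential descent (MCD) applied to $f$ with parameters $\{\nu_n\},\{\mu_n\}\subset[0,+\infty]$, and let the sequences of sets $\{\underline{d}f(x_n)\}$ and $\{\overline{d}f(x_n)\}$ be bounded (i.e. lie within a bounded set). Suppose also that $\liminf_{n\to\infty}\nu_n=\nu^*>0$, there exists $r>0$ such that $B(x_n,r)\subset U$ for all $n\in\mathbb{N}$, and the codifferential mapping $Df$ uniformly approximates $f$ on the set $\{x_n\}_{n\ge m}$ for some $m\in\mathbb{N}$ (in particular, one can suppose that $Df$ uniformly approximates $f$ on the set $\{x\in U\mid f(x)\le f(x_0)\}$). Then $\omega(x_n,\nu_n)\to0$ as $n\to\infty$, where $$\omega(x,\nu)=\sup_{(0,w)\in\overline{d}f(x)}\ \min_{u\in\operatorname{cl}\operatorname{co}\underline{d}_\nu f(x)+(0,w)}\|u\|^2 .$$ In particular, if $f$ is hypodifferentiable with $Df(\cdot)=[\underline{d}f(\cdot),\{0\}]$, and $\nu_n\equiv+\infty$, then $\operatorname{dist}(0,\underline{d}f(x_n))\to0$ as $n\to\infty$.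
   Context: Codifferentials. $\mathcal{H}$ is a real Hilbert space with inner product $\langle\cdot,\cdot\rangle$, $B(y,r)=\{z\in\mathcal{H}\mid\|z-y\|\le r\}$, and $\mathbb{R}\times\mathcal{H}$ carries the inner product $\langle(a,v),(b,w)\rangle=ab+\langle v,w\rangle$ and the corresponding norm. A function $f$ defined in a neighbourhood of $x$ is codifferentiable at $x$ if there exist (nonempty) weakly compact convex sets $\underline{d}f(x),\overline{d}f(x)\subset\mathbb{R}\times\mathcal{H}$ such that for any $\Delta x\in\mathcal{H}$ $$\lim_{\alpha\to+0}\frac1\alpha\Big|f(x+\alpha\Delta x)-f(x)-\max_{(a,v)\in\underline{d}f(x)}(a+\alpha\langle v,\Delta x\rangle)-\min_{(b,w)\in\overline{d}f(x)}(b+\alpha\langle w,\Delta x\rangle)\Big|=0$$ and $\max_{(a,v)\in\underline{d}f(x)}a+\min_{(b,w)\in\overline{d}f(x)}b=0$. The pair $Df(x)=[\underline{d}f(x),\overline{d}f(x)]$ is called a codifferential of $f$ at $x$. Throughout, codifferentials are normalized: $\max_{(a,v)\in\underline{d}f(x)}a=\min_{(b,w)\in\overline{d}f(x)}b=0$. If there is a codifferential of the form $[\underline{d}f(x),\{0\}]$, $f$ is called hypodifferentiable at $x$. Setting. $U\subseteq\mathcal{H}$ is open, $f\colon U\to\mathbb{R}$ is codifferentiable on $U$, and a codifferential mapping $x\mapsto Df(x)$, $x\in U$, is fixed. For $B(x,r)\subset U$, $\Delta x\in B(0,r)$, $\alpha\in(0,1]$ put $$\varepsilon_f(\alpha,\Delta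 x,x,r)=\frac1\alpha\Big(f(x+\alpha\Delta x)-f(x)-\max_{(a,v)\in\underline{d}f(x)}(a+\alpha\langle v,\Delta x\rangle)-\min_{(b,w)\in\overline{d}f(x)}(b+\alpha\langle w,\Delta x\rangle)\Big).$$ $Df$ uniformly approximates $f$ on a set $C\subset U$ if there exists $r>0$ such that $B(x,r)\subseteq U$ for all $x\in C$ and $\varepsilon_f(\alpha,\Delta x,x,r)\to0$ as $\alpha\to+0$ uniformly for all $\Delta x\in B(0,r)$ and $x\in C$. Truncated codifferential ($\operatorname{ext}$ = set of extreme points). For all $\nu,\mu\in[0,+\infty]$, set-valued mappings $\underline{d}_\nu f,\overline{d}_\mu f\colon U\rightrightarrows\mathbb{R}\times\mathcal{H}$ are given such that for all $x\in U$: $\{(a,v)\in\operatorname{ext}\underline{d}f(x)\mid a\ge-\nu\}\subseteq\underline{d}_\nu f(x)\subseteq\underline{d}f(x)$ and $\{(b,w)\in\operatorname{ext}\overline{d}f(x)\mid b\le\mu\}\subseteq\overline{d}_\mu f(x)\subseteq\overline{d}f(x)$. MCD. Choose sequences $\{\nu_n\},\{\mu_n\}\subset[0,+\infty]$, $\alpha_*\in(0,+\infty]$ and $x_0\in U$ (if $\alpha_*=+\infty$, then $[0,\alpha_*]$ means $[0,+\infty)$). At iteration $n\ge0$: for every $z\in\overline{d}_{\mu_n}f(x_n)$ let $(a_n(z),v_n(z))$ be the element of least norm of $\operatorname{cl}\operatorname{co}\underline{d}_{\nu_n}f(x_n)+z$; choose $\alpha_n(z)\in\arg\min\{f(x_n-\alpha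 v_n(z))\mid\alpha\in[0,\alpha_*],\ x_n-\alpha v_n(z)\in U\}$; choose $z_n\in\arg\min\{f(x_n-\alpha_n(z)v_n(z))\mid z\in\overline{d}_{\mu_n}f(x_n)\}$; and set $x_{n+1}=x_n-\alpha_n(z_n)v_n(z_n)$. It is assumed that $\alpha_n(z)$ and $z_n$ are well defined (the minima are attained) at every iteration. *)

(* Defs.v *)
From HB Require Import structures.
From mathcomp Require Import all_boot all_order all_algebra.
From mathcomp Require Import all_classical all_reals all_analysis.

Set Implicit Arguments.
Unset Strict Implicit.
Unset Printing Implicit Defensive.

Import Order.TTheory GRing.Theory Num.Theory.
Import numFieldNormedType.Exports.

Local Open Scope classical_set_scope.
Local Open Scope ring_scope.

Definition argmin (R : realType) (T : Type) (g : T -> R) (A : set T) : set T :=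
  [set t | A t /\ forall s, A s -> g t <= g s].

Definition conv_hull (R : realType) (E : lmodType R) (A : set E) : set E :=
  smallest (@convex_set R E) A.

Definition ext (R : realType) (E : lmodType R) (A : set E) : set E :=
  [set p | A p /\ forall q r (t : R), A q -> A r -> 0 < t -> t < 1 ->
                    p = t *: q + (1 - t) *: r -> q = p /\ r = p].

(* The weak topology: the coarsest one for which every norm-continuous linear
   functional is continuous. *)
Definition weak (R : realType) (E : normedModType R) : topologicalType :=
  @sup_topology E {phi : {linear E -> R^o} | continuous phi}
    (fun phi => Topological.on (initial_topology (sval phi))).

Definition weakly_compact (R : realType) (E : normedModType R) (A : set E) :=
  compact (A : set (weak E)).

(* The product R x H. Its library norm is the max norm, which induces the same
   norm topology, weak topology and bounded sets as the Hilbert norm hnorm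
   below; every metric notion (least norm, omega, distance) uses hnorm. *)
Notation RxH R H := (R^o * H)%type.

Section HilbertProduct.
Variables (R : realType) (H : completeNormedModType R).
Variable dot : H -> H -> R.

Definition hdot (p q : RxH R H) : R := p.1 * q.1 + dot p.2 q.2.

Definition hnorm (p : RxH R H) : R := Num.sqrt (hdot p p).

Definition hdist0 (A : set (RxH R H)) : \bar R :=
  ereal_inf [set (hnorm p)%:E | p in A].

(* cl co A + z *)
Definition clco_add (A : set (RxH R H)) (z : RxH R H) : set (RxH R H) :=
  [set p + z | p in closure (conv_hull A)].

(* max_{(a,v) in A} (a + alpha <v,dx>) and min_{(b,w) in A} (b + alpha <w,dx>);
   for nonempty weakly compact A these sup and inf are finite and attained. *)
Definition hypo (A : set (RxH R H)) (alpha : R) (dx : H) : R :=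
  sup [set p.1 + alpha * dot p.2 dx | p in A].

Definition hyper (A : set (RxH R H)) (alpha : R) (dx : H) : R :=
  inf [set p.1 + alpha * dot p.2 dx | p in A].

Definition residual (f : H -> R) (x : H) (Dl Du : set (RxH R H))
    (alpha : R) (dx : H) : R :=
  f (x + alpha *: dx) - f x - hypo Dl alpha dx - hyper Du alpha dx.

(* [Dl, Du] is a codifferential of f at x. Only the values of f near x matter,
   so a function given on an open set is represented by any total extension. *)
Definition is_codifferential (f : H -> R) (x : H) (Dl Du : set (RxH R H)) :=
  [/\ [/\ Dl !=set0, weakly_compact Dl & convex_set Dl],
      [/\ Du !=set0, weakly_compact Du & convex_set Du],
      forall dx : H,
        alpha^-1 * `|residual f x Dl Du alpha dx| @[alpha --> 0^'+] --> (0 : R)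
    & sup [set p.1 | p in Dl] + inf [set p.1 | p in Du] = 0].

Definition normalized (Dl Du : set (RxH R H)) :=
  sup [set p.1 | p in Dl] = 0 /\ inf [set p.1 | p in Du] = 0.

(* The radius r of B(x, r) only restricts the admissible dx, so it is not an
   argument here. *)
Definition eps (f : H -> R) (dl du : H -> set (RxH R H))
    (alpha : R) (dx x : H) : R :=
  alpha^-1 * residual f x (dl x) (du x) alpha dx.

Definition uniformly_approximates (U : set H) (f : H -> R)
    (dl du : H -> set (RxH R H)) (C : set H) :=
  C `<=` U /\
  exists2 r : R, 0 < r &
    (forall x, C x -> closed_ball_ Num.norm x r `<=` U) /\
    (forall e : R, 0 < e -> \forall alpha \near 0^'+,
       forall dx x, closed_ball_ Num.norm 0 r dx -> C x ->
         `|eps f dl du alpha dx x| < e).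

Definition is_lower_truncation (U : set H) (dl : H -> set (RxH R H))
    (dlt : \bar R -> H -> set (RxH R H)) :=
  forall (nu : \bar R) x, (0 <= nu)%E -> U x ->
    [set p | ext (dl x) p /\ (- nu <= p.1%:E)%E] `<=` dlt nu x /\
    dlt nu x `<=` dl x.

Definition is_upper_truncation (U : set H) (du : H -> set (RxH R H))
    (dut : \bar R -> H -> set (RxH R H)) :=
  forall (mu : \bar R) x, (0 <= mu)%E -> U x ->
    [set p | ext (du x) p /\ (p.1%:E <= mu)%E] `<=` dut mu x /\
    dut mu x `<=` du x.

(* One iteration x |-> x' of the method of codifferential descent, for the
   truncated sets L of the hypodifferential and M of the hyperdifferential;
   av z is the pair (a(z), v(z)). *)
Definition mcd_step (U : set H) (f : H -> R) (L M : set (RxH R H))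
    (alphastar : \bar R) (x x' : H) :=
  exists (av : RxH R H -> RxH R H) (alpha : RxH R H -> R) (z0 : RxH R H),
  [/\ forall z, M z -> argmin hnorm (clco_add L z) (av z),
      forall z, M z ->
        argmin (fun s => f (x - s *: (av z).2))
          [set s | [/\ 0 <= s, (s%:E <= alphastar)%E & U (x - s *: (av z).2)]]
          (alpha z),
      argmin (fun z => f (x - alpha z *: (av z).2)) M z0
    & x' = x - alpha z0 *: (av z0).2].

Definition omega (dlt : \bar R -> H -> set (RxH R H))
    (du : H -> set (RxH R H)) (x : H) (nu : \bar R) : \bar R :=
  ereal_sup [set ereal_inf [set (hnorm u ^+ 2)%:E
                           | u in clco_add (dlt nu x) (0, w)]
            | w in [set w | du x (0, w)]].

End HilbertProduct.

(* Main.v *)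
Require Import Defs.
From HB Require Import structures.
From mathcomp Require Import all_boot all_order all_algebra.
From mathcomp Require Import all_classical all_reals all_analysis.
From mathcomp Require Import ring lra.

Set Implicit Arguments.
Unset Strict Implicit.
Unset Printing Implicit Defensive.

Import Order.TTheory GRing.Theory Num.Theory.
Import numFieldNormedType.Exports.

Local Open Scope classical_set_scope.
Local Open Scope ring_scope.

(** Fix [e > 0].  Whenever [omega (x n) (nu n)] exceeds [e], with [n] large, one
    step of the method decreases [f] by at least a positive amount that does not
    depend on [n]; as [f (x n)] is nonincreasing and bounded below, this happens
    finitely often.

    The decrease is obtained at a fixed small step length.  Let [z = (0, w)] be
    a point that the method examines, let [C] be the closed convex hull of the
    truncated hypodifferential, and let [p = (a, v)] be the element of least
    norm of [C + z], with [|p|^2 >= th].  The model of [f] along [- v] is the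
    sum of a maximum over the hypodifferential, attained at some [q], and of a
    minimum over the hyperdifferential, which is at most the value at [z]; so
    for a step [b] it is at most
    [q.1 - b <q.2 + w, v> = q.1 (1 + b a) - b <q + z, p>].
    The variational inequality [<q + z, p> >= |p|^2] and [q.1 <= 0] bound this
    by [- b th] as soon as [b |a| <= 1] ([model_decrease]).  Uniform
    approximation turns the decrease of the model into one of [f], with the same
    [b] for all iterates ([sufficient_decrease]).

    Two points need an argument of Krein-Milman type, because the truncations
    are only known to contain certain extreme points.
    - The maximum must be attained at a [q] in the truncated set: a linear
      functional attains its maximum over a weakly compact set at an extreme
      point, and for short steps a maximizer cannot have a first coordinate
      below [- nu] ([hypo_le_truncation]).
    - The supremum defining [omega] is over all [(0, w)] in the
      hyperdifferential, while the method is only known to examine the extreme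
      ones.  If [C + (0, w)] is far from the origin, it lies, up to a small
      error, in a half-space [<., p> >= |p|^2]; moving [(0, w)] to an extreme
      point of the face [{b = 0}] that maximizes [<., p>] keeps [C + z] in this
      half-space ([ext_far_from_origin]).
    Both follow from [lexicographic_max_ext]. *)

(** * Extreme points of weakly compact sets *)

Section ExtremePoints.
Variables (R : realType) (E : normedModType R).
Implicit Types (K G : set (weak E)) (phi psi : {linear E -> R^o}).

Lemma weak_continuous phi : continuous phi ->
  continuous (phi : weak E -> R).
Proof.
move=> cphi x.
have /cvg_sup/(_ (exist _ phi cphi)) xx : nbhs (x : weak E) --> (x : weak E).
  by [].
apply: cvg_trans (@initial_continuous E R^o phi x).
by apply: cvg_app; exact: xx.
Qed.

Definition extreme_subset K (F : set E) :=
  F `<=` K /\ forall p q r (t : R), F p -> K q -> K r -> 0 < t -> t < 1 ->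
    p = t *: q + (1 - t) *: r -> F q /\ F r.

(** The closed set [G] cuts a nonempty face [K `&` G] out of [K].  The ambient
    [G] is recorded, since the face itself is closed only relatively to [K]. *)
Definition is_face K G :=
  [/\ closed G, K `&` G !=set0 & extreme_subset K (K `&` G)].

Lemma face_argmax K G phi : compact K -> continuous phi -> is_face K G ->
  exists2 c, is_face K (G `&` [set p : weak E | c <= phi p]) &
             forall p, K p -> G p -> phi p <= c.
Proof.
move=> cK cphi [cG KG0 [_ eKG]].
have wphi := weak_continuous cphi.
have [||p0 /set_mem[Kp0 Gp0] pmax] := @compact_EVT_max (weak E) R phi (K `&` G) KG0.
- exact: compact_closedI.
- exact: continuous_subspaceT.
have phi_le p : K p -> G p -> phi p <= phi p0.
  by move=> Kp Gp; apply: pmax; exact: mem_set.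
exists (phi p0) => //; split.
- apply: closedI => //.
  apply: (@preimage_closed (weak E) R phi [set c | phi p0 <= c]).
    by move=> ? _; exact: wphi.
  exact: closed_ge.
- by exists p0; split => //; split => //=.
- split=> [p []//|p q r t [Kp [Gp /= p0p]] Kq Kr t0 t1 pE].
  have [[_ Gq] [_ Gr]] := eKG p q r t (conj Kp Gp) Kq Kr t0 t1 pE.
  have qle := phi_le q Kq Gq; have rle := phi_le r Kr Gr.
  have phipE : phi p = t * phi q + (1 - t) * phi r.
    by rewrite pE linearD !linearZ.
  by split; split => //; split => //=; nra.
Qed.

Hypothesis separated : forall p q : E, p != q ->
  exists2 phi : {linear E -> R^o}, continuous phi & phi p < phi q.

(** A minimal face is a single point: a functional separating two of its points
    would cut out a smaller face.  Minimal faces exist by Zorn's lemma, since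
    compactness keeps the intersection of a chain of faces nonempty. *)
Lemma face_has_ext K G : compact K -> is_face K G -> exists2 p, ext K p & G p.
Proof.
move=> cK faceG.
(* Zorn's lemma is applied to what is removed from [G], ordered by inclusion. *)
pose P := [set A : set (weak E) | is_face K (G `\` A)].
have [F FP Ftot|A [PA Amax]] := @Zorn_bigcup _ P.
  (* The empty chain: nothing is removed. *)
  have [->|/set0P[A0 FA0]] := eqVneq F set0.
    by rewrite /P /= bigcup_set0 setD0.
  have GDE : G `\` \bigcup_(X in F) X = \bigcap_(X in F) (G `\` X).
    apply/seteqP; split=> p.
      by move=> [Gp Fp] X FX; split=> // Xp; apply: Fp; exists X.
    move=> Fp; split; first by have [] := Fp _ FA0.
    by move=> [X FX Xp]; have [] := Fp _ FX.
  have closedF : closed (\bigcap_(X in F) (G `\` X)).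
    by apply: closed_bigI => X /FP[].
  rewrite /P /= GDE; split => //.
    pose B := filter_from F (fun X => K `&` (G `\` X)).
    have BP : ProperFilter B.
      apply: filter_from_proper; last by move=> X /FP[].
      apply: filter_from_filter; first by exists A0.
      move=> X Y FX FY; have [XY|YX] := Ftot _ _ FX FY.
        by exists Y => // p [Kp [Gp nYp]]; split; split => //; split=> // /XY.
      by exists X => // p [Kp [Gp nYp]]; split; split => //; split=> // /YX.
    have [|p [Kp clp]] := cK B BP; first by exists A0 => // p [].
    exists p; split => // X FX; have [cX _ _] := FP _ FX; apply: cX.
    by move=> V Vp; have /(_ V) := clp (G `\` X); apply => //; exists X => // ? [].
  split=> [p []//|p q r t [Kp Fp] Kq Kr t0 t1 pE].
  have qr X : F X -> (K `&` (G `\` X)) q /\ (K `&` (G `\` X)) r.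
    move=> FX; have [_ _ [_ eX]] := FP _ FX.
    by apply: (eX p q r t) => //; split => //; exact: Fp.
  by split; split => // X /qr[[]] ? ? [].
have [_ [p [Kp GAp]] [_ eGA]] := PA.
have uniq q : K q -> (G `\` A) q -> q = p.
  move=> Kq GAq; apply/eqP/negPn/negP => /separated[phi cphi qp].
  have [c faceC cmax] := face_argmax cK cphi PA.
  apply: (Amax (A `|` [set q | phi q < c])).
    split; first by move=> ? ?; left.
    move=> /(_ q)/=; have : phi q < c by apply: lt_le_trans qp _; exact: cmax.
    by move=> qc /(_ (or_intror qc)); case: GAq.
  rewrite /P /=; congr (is_face K _): faceC.
  apply/seteqP; split=> s /=.
    by move=> [[Gs nAs] cs]; split => // -[//|]; rewrite ltNge cs.
  move=> [Gs nAs]; split; first by split => // As; apply: nAs; left.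
  by rewrite leNgt; apply/negP => ?; apply: nAs; right.
exists p; last by case: GAp.
split => // q r t Kq Kr t0 t1 pE.
have [[_ GAq] [_ GAr]] := eGA p q r t (conj Kp GAp) Kq Kr t0 t1 pE.
by split; exact: uniq.
Qed.

(** Maximizing [psi] over the face of the maximizers of [phi] gives again a face,
    and an extreme point of a face is an extreme point of the whole set. *)
Lemma lexicographic_max_ext K phi psi q : compact K -> K q ->
    continuous phi -> continuous psi -> (forall p, K p -> phi p <= phi q) ->
  exists p, [/\ ext K p, phi p = phi q & psi q <= psi p].
Proof.
move=> cK Kq cphi cpsi qmax.
have faceT : is_face K setT.
  split; first exact: closedT.
    by exists q.
  by rewrite setIT; split.
have [c facec cmax] := face_argmax cK cphi faceT.
have qc : c <= phi q.
  by have [_ [p [Kp [_ cp]]] _] := facec; apply: le_trans cp _; exact: qmax.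
have [d faced dmax] := face_argmax cK cpsi facec.
have [p pext [[_ /= cp] /= dp]] := face_has_ext cK faced.
have Kp : K p by case: pext.
exists p; split => //.
  apply/eqP; rewrite eq_le qmax //=; apply: le_trans cp; exact: cmax.
by apply: le_trans dp; exact: dmax.
Qed.

End ExtremePoints.

(** * Convexity and closure *)

Section Convexity.
Variables (R : realType) (E : normedModType R).
Implicit Types A : set E.

Lemma convex_setP A : convex_set A <->
  forall p q (t : R), A p -> A q -> 0 <= t -> t <= 1 ->
    A (t *: p + (1 - t) *: q).
Proof.
split=> [cA p q t Ap Aq t0 t1|cA p q t /set_mem Ap /set_mem Aq]; last first.
  by apply/mem_set; exact: cA.
have t01 : Itv.spec (@Itv.num_sem R) (Itv.Real `[0%Z, 1%Z]) t.
  by apply/and3P; split; rewrite //= ?num_real ?in_itv/= ?t0.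
by have := cA p q (Itv.mk t01) (mem_set Ap) (mem_set Aq) => /set_mem.
Qed.

Lemma convex_conv_hull A : convex_set (conv_hull A).
Proof.
apply/convex_setP => p q t Ap Aq t0 t1 B [cB AB].
by move/convex_setP : (cB); apply => //; [exact: Ap|exact: Aq].
Qed.

Lemma convex_closure A : convex_set A -> convex_set (closure A).
Proof.
move=> /convex_setP cA; apply/convex_setP => p q t clp clq t0 t1 V Vpq.
have conv_cts : (fun z : E * E => t *: z.1 + (1 - t) *: z.2) @ (p, q) -->
    t *: p + (1 - t) *: q.
  apply: cvgD; apply: cvgZr; [exact: cvg_fst|exact: cvg_snd].
have [[P Q] /= [Pp Qq] PQV] := conv_cts _ Vpq.
have [a [Aa Pa]] := clp _ Pp; have [b [Ab Qb]] := clq _ Qq.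
exists (t *: a + (1 - t) *: b); split; first exact: cA.
exact: (PQV (a, b)).
Qed.

Lemma convex_translate A z : convex_set A -> convex_set [set p + z | p in A].
Proof.
move=> /convex_setP cA; apply/convex_setP => _ _ t [p Ap <-] [q Aq <-] t0 t1.
exists (t *: p + (1 - t) *: q); first exact: cA.
by rewrite !scalerDr addrACA -[in RHS]scalerDl [t + _]addrC subrK scale1r.
Qed.

Lemma closure_conv_hull_bounded A M :
  (forall p, A p -> `|p| <= M) -> forall p, closure (conv_hull A) p -> `|p| <= M.
Proof.
move=> AM.
have AB : conv_hull A `<=` [set p | `|p| <= M].
  apply: smallest_sub => //; apply/convex_setP => p q t /= pM qM t0 t1.
  rewrite (le_trans (ler_normD _ _))// !normrZ !ger0_norm ?subr_ge0//.
  nra.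
suff cB : closed [set p : E | `|p| <= M] by move=> p /(closureS AB); exact: cB.
apply: (@preimage_closed E R (fun p => `|p|) [set c | c <= M]).
  by move=> ? _; exact: norm_continuous.
exact: closed_le.
Qed.

End Convexity.

(** * The Hilbert structure of the product *)

Section HilbertSpace.
Variables (R : realType) (H : completeNormedModType R).
Variable dot : {dot H for idfun}.
Hypothesis norm_dot : forall x : H, `|x| ^+ 2 = dot x x.
Local Notation RH := (RxH R H).
Local Notation hdot := (hdot dot).
Local Notation hnorm := (hnorm dot).
Implicit Types (u v w : H) (p q r s : RH) (A : set RH).

Lemma dotC u v : dot u v = dot v u.
Proof. by have := hermC dot u v; rewrite expr0 mul1r. Qed.

Lemma dotDr u v w : dot u (v + w) = dot u v + dot u w.
Proof. exact: linearDr. Qed.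

Lemma dotZr u (t : R) v : dot u (t *: v) = t * dot u v.
Proof. exact: linearZr. Qed.

Lemma dotNr u v : dot u (- v) = - dot u v.
Proof. by rewrite -scaleN1r dotZr mulN1r. Qed.

(** Polarization gives the continuity of [dot] from that of the norm, and the
    Cauchy-Schwarz inequality from the triangle inequality. *)
Lemma polarization u v :
  dot u v = 2^-1 * (`|u + v| ^+ 2 - `|u| ^+ 2 - `|v| ^+ 2).
Proof.
rewrite !norm_dot dotDr ![dot (u + v) _]dotC !dotDr [dot v u]dotC.
by field.
Qed.

Lemma dot_le_norm u v : dot u v <= `|u| * `|v|.
Proof.
rewrite polarization; have := ler_normD u v; have := normr_ge0 (u + v).
by move: (normr_ge0 u) (normr_ge0 v); nra.
Qed.

Lemma normr_dot_le u v : `|dot u v| <= `|u| * `|v|.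
Proof.
by rewrite ler_norml dot_le_norm andbT lerNl -dotNr -(normrN v) dot_le_norm.
Qed.

Lemma continuous_dot u : continuous (dot u).
Proof.
move=> v; rewrite /continuous_at [X in _ --> X]polarization.
rewrite (_ : dot u = fun w => 2^-1 * (`|u + w| ^+ 2 - `|u| ^+ 2 - `|w| ^+ 2)).
  2: by apply/funext => w; exact: polarization.
have sqr_norm_cvg (g : H -> H) : continuous g ->
    `|g w| ^+ 2 @[w --> v] --> `|g v| ^+ 2.
  by move=> cg; apply: cvgM; apply: cvg_norm; exact: cg.
apply: cvgM; first exact: cvg_cst.
apply: cvgB; last by apply: (sqr_norm_cvg id) => w; exact: cvg_id.
apply: cvgB; last exact: cvg_cst.
by apply: (sqr_norm_cvg (fun w => u + w)) => w; apply: cvgD;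
  [exact: cvg_cst|exact: cvg_id].
Qed.

Lemma hdotC p q : hdot p q = hdot q p.
Proof. by rewrite /Defs.hdot mulrC dotC. Qed.

Lemma hdotDr p q r : hdot p (q + r) = hdot p q + hdot p r.
Proof.
by rewrite /Defs.hdot /= dotDr [q.1 + r.1]/(q.1 + r.1 : R) mulrDr addrACA.
Qed.

Lemma hdotZr p (t : R) q : hdot p (t *: q) = t * hdot p q.
Proof. by rewrite /Defs.hdot /= dotZr [t *: q.1]/(t * q.1) mulrDr mulrCA. Qed.

Lemma hdotNr p q : hdot p (- q) = - hdot p q.
Proof. by rewrite -scaleN1r hdotZr mulN1r. Qed.

Lemma hdotBr p q r : hdot p (q - r) = hdot p q - hdot p r.
Proof. by rewrite hdotDr hdotNr. Qed.

Lemma hdot_ge0 p : 0 <= hdot p p.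
Proof. by rewrite /Defs.hdot -norm_dot; nra. Qed.

Lemma hnorm_sqr p : hnorm p ^+ 2 = hdot p p.
Proof. by rewrite sqr_sqrtr // hdot_ge0. Qed.

Lemma hdot_gt0 p : p != 0 -> 0 < hdot p p.
Proof.
move=> p0; rewrite lt_neqAle hdot_ge0 andbT eq_sym; apply: contra p0.
rewrite /Defs.hdot -norm_dot paddr_eq0 -?expr2 ?sqr_ge0// !expf_eq0/= normr_eq0.
by case: p => a v /= /andP[/eqP-> /eqP->].
Qed.

Lemma hdot_is_linear p : linear (hdot p : RH -> R^o).
Proof. by move=> t q r; rewrite hdotDr hdotZr. Qed.

HB.instance Definition _ p :=
  GRing.isLinear.Build R RH R^o _ (hdot p : RH -> R^o) (hdot_is_linear p).

Lemma continuous_hdot p : continuous (hdot p : RH -> R^o).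
Proof.
move=> q; apply: cvgD; first by apply: cvgM; [exact: cvg_cst|exact: cvg_fst].
apply: (cvg_comp _ _ cvg_snd); exact: continuous_dot.
Qed.

Lemma hdot_separated p q : p != q ->
  exists2 phi : {linear RH -> R^o}, continuous phi & phi p < phi q.
Proof.
move=> pq; exists (hdot (q - p) : RH -> R^o); first exact: continuous_hdot.
by rewrite -subr_gt0 -hdotBr hdot_gt0 // subr_eq0 eq_sym.
Qed.

Lemma fst_norm_le p : `|p.1| <= `|p|.
Proof. by rewrite prod_normE le_max lexx. Qed.

Lemma snd_norm_le p : `|p.2| <= `|p|.
Proof. by rewrite prod_normE le_max lexx orbT. Qed.

(** The norm on the right is the max norm of the product, in which boundedness is
    expressed; hence the factor 2. *)
Lemma hdot_le_normM p q : hdot p q <= 2 * (`|p| * `|q|).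
Proof.
have := dot_le_norm p.2 q.2; rewrite /Defs.hdot.
have : p.1 * q.1 <= `|p.1| * `|q.1| by rewrite -normrM ler_norm.
move: (fst_norm_le p) (snd_norm_le p) (fst_norm_le q) (snd_norm_le q).
move: (normr_ge0 p.1) (normr_ge0 p.2) (normr_ge0 q.1) (normr_ge0 q.2).
by nra.
Qed.

Lemma continuous_hnorm : continuous hnorm.
Proof.
have -> : hnorm = fun p => Num.sqrt (p.1 * p.1 + `|p.2| * `|p.2|).
  by apply/funext => p; rewrite /Defs.hnorm /Defs.hdot -norm_dot expr2.
move=> p; apply: continuous_comp; last exact: sqrt_continuous.
apply: cvgD; first by apply: cvgM; exact: cvg_fst.
by apply: cvgM; apply: cvg_norm; exact: cvg_snd.
Qed.

Lemma hdot_lexicographic_max_ext A p q s : weakly_compact A -> A s ->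
    (forall r, A r -> hdot p r <= hdot p s) ->
  exists r, [/\ ext A r, hdot p r = hdot p s & hdot q s <= hdot q r].
Proof.
move=> cA As smax.
by apply: (@lexicographic_max_ext R RH hdot_separated A (hdot p) (hdot q) s);
  do ?exact: continuous_hdot.
Qed.

Lemma hdot_max A p : weakly_compact A -> A !=set0 ->
  exists2 s, A s & forall r, A r -> hdot p r <= hdot p s.
Proof.
move=> cA A0.
have [|s /set_mem As smax] := @compact_EVT_max (weak RH) R (hdot p) A A0 cA.
  apply: continuous_subspaceT; apply: weak_continuous; exact: continuous_hdot.
by exists s => // r Ar; apply: smax; exact: mem_set.
Qed.

(** Otherwise a short move from [p] towards [q] would decrease the norm. *)
Lemma argmin_hnorm_variational A p : convex_set A -> argmin hnorm A p ->
  forall q, A q -> hdot p p <= hdot p q.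
Proof.
move=> /convex_setP cA [Ap pmin] q Aq; rewrite leNgt; apply/negP => pq.
set d := hdot p p - hdot p q; have d0 : 0 < d by rewrite subr_gt0.
set k := hdot (q - p) (q - p); have k0 : 0 <= k := hdot_ge0 _.
(* A step below the minimizer [d / k] of the norm along the segment, and at
   most 1; the denominator is positive even when [k = 0]. *)
pose t := d / (d + k + d).
have dk0 : 0 < d + k + d by lra.
have t0 : 0 < t by rewrite divr_gt0.
have t1 : t <= 1 by rewrite ler_pdivrMr //; lra.
have tE : t * (d + k + d) = d by rewrite divfK // gt_eqF.
have := pmin _ (cA q p t Aq Ap (ltW t0) t1).
have -> : t *: q + (1 - t) *: p = p + t *: (q - p).
  by rewrite scalerBl scale1r scalerBr addrCA.
rewrite -(@ler_pXn2r _ 2) ?nnegrE ?sqrtr_ge0 // !hnorm_sqr.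
rewrite hdotDr hdotZr ![hdot (p + _) _]hdotC hdotDr hdotZr hdotBr.
rewrite [hdot (q - p) (p + _)]hdotDr hdotZr -/k [hdot (q - p) p]hdotC hdotBr.
move: tE t0 t1 d0 k0; rewrite /d; clearbody t k; nra.
Qed.

(** A point whose squared norm is within [t * e] of the infimum, where [t] is small
    with respect to the diameter, satisfies the variational inequality up to
    [e]. *)
Lemma approximate_projection A (K e : R) : convex_set A -> A !=set0 ->
    (forall p q, A p -> A q -> hdot (q - p) (q - p) <= K) -> 0 < e ->
  exists2 p, A p & forall q, A q -> hdot p p - e <= hdot p q.
Proof.
move=> /convex_setP cA [p0 Ap0] AK e0.
have K0 : 0 <= K by apply: le_trans (AK _ _ Ap0 Ap0); exact: hdot_ge0.
pose t := e / (e + K).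
have eK : 0 < e + K by lra.
have t0 : 0 < t by rewrite divr_gt0.
have t1 : t <= 1 by rewrite ler_pdivrMr //; lra.
have tE : t * (e + K) = e by rewrite divfK // gt_eqF.
have lbA : has_inf [set hdot p p | p in A].
  split; first by exists (hdot p0 p0); exists p0.
  by exists 0 => _ [p _ <-]; exact: hdot_ge0.
have [_ [p Ap <-] pinf] := inf_adherent (mulr_gt0 t0 e0) lbA.
exists p => // q Aq.
have : hdot p p - t * e <= hdot (t *: q + (1 - t) *: p) (t *: q + (1 - t) *: p).
  rewrite lerBlDr (le_trans (ltW pinf))// lerD2r.
  apply: ge_inf; first by case: lbA.
  by exists (t *: q + (1 - t) *: p) => //; apply: cA => //; exact: ltW.
have -> : t *: q + (1 - t) *: p = p + t *: (q - p).
  by rewrite scalerBl scale1r scalerBr addrCA.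
rewrite hdotDr hdotZr ![hdot (p + _) _]hdotC hdotDr hdotZr hdotBr.
rewrite [hdot (q - p) (p + _)]hdotDr hdotZr [hdot (q - p) p]hdotC hdotBr.
have := AK _ _ Ap Aq; move: (hdot (q - p) (q - p)) => k kK kE.
have : t * (2 * (hdot p q - hdot p p) + t * k + e) >= 0 by lra.
rewrite pmulr_rge0 // => kE'.
have : t * k <= e by nra.
lra.
Qed.


(** * The model of the function along a descent direction *)

(** The affine forms of the codifferential at a fixed displacement are linear
    functionals on the product, to which the results on extreme points apply. *)
Lemma affine_hdot (a : R) u p : p.1 + a * dot p.2 u = hdot (1, a *: u) p.
Proof. by rewrite /Defs.hdot /= mul1r [dot (a *: u) _]dotC dotZr. Qed.

Lemma hdot_fst (a : R) p : hdot (a, 0) p = a * p.1.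
Proof.
by rewrite /Defs.hdot /= dotC -[X in dot _ X](scale0r (0 : H)) dotZr mul0r addr0.
Qed.

Lemma sup_fst_attained A : weakly_compact A -> A !=set0 ->
    sup [set p.1 | p in A] = 0 ->
  (forall p, A p -> p.1 <= 0) /\ exists2 p, A p & p.1 = 0.
Proof.
move=> cA A0 sup0; have [s As smax] := hdot_max (1, 0) cA A0.
have ub : ubound [set p.1 | p in A] s.1.
  by move=> _ [p Ap <-]; have := smax _ Ap; rewrite !hdot_fst; lra.
have s0 : s.1 = 0.
  apply/eqP; rewrite eq_le -{1}sup0 -{1}sup0; apply/andP; split.
    by apply: ub_le_sup; [exists s.1|exists s].
  by apply: ge_sup => //; exists s.1, s.
split; last by exists s.
by move=> p Ap; rewrite -s0; apply: ub; exists p.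
Qed.

Lemma inf_fst_attained A : weakly_compact A -> A !=set0 ->
    inf [set p.1 | p in A] = 0 ->
  (forall p, A p -> 0 <= p.1) /\ exists2 p, A p & p.1 = 0.
Proof.
move=> cA A0 inf0; have [s As smax] := hdot_max (-1, 0) cA A0.
have lb : lbound [set p.1 | p in A] s.1.
  by move=> _ [p Ap <-]; have := smax _ Ap; rewrite !hdot_fst; lra.
have s0 : s.1 = 0.
  apply/eqP; rewrite eq_le -{1}inf0 -{1}inf0; apply/andP; split.
    by apply: lb_le_inf => //; exists s.1, s.
  by apply: ge_inf; [exists s.1|exists s].
split; last by exists s.
by move=> p Ap; rewrite -s0; apply: lb; exists p.
Qed.

Lemma hyper_le A (a : R) u p : weakly_compact A -> A p ->
  hyper dot A a u <= p.1 + a * dot p.2 u.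
Proof.
move=> cA Ap; have [s As smax] := hdot_max (- (1, a *: u)) cA (ex_intro _ p Ap).
apply: ge_inf; last by exists p.
exists (s.1 + a * dot s.2 u) => _ [q Aq <-].
by have := smax _ Aq; rewrite ![hdot (- _) _]hdotC !hdotNr lerN2 !affine_hdot
  ![hdot _ (1, _)]hdotC.
Qed.

(** At a maximizer the first coordinate is at least minus the variation
    [2 * a * M * |u|] of the linear terms, since the value at a point of first
    coordinate 0 is a lower bound for the maximum.  So an extreme maximizer
    survives the truncation at level [nu]. *)
Lemma hypo_le_truncation A (L : set RH) (a nu M : R) u :
    weakly_compact A -> A !=set0 -> sup [set p.1 | p in A] = 0 ->
    (forall p, A p -> `|p| <= M) -> 0 <= a -> 2 * (a * (M * `|u|)) <= nu ->
    [set p | ext A p /\ - nu <= p.1] `<=` L ->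
  exists2 p, L p & hypo dot A a u <= p.1 + a * dot p.2 u.
Proof.
move=> cA A0 sup0 AM a0 aM_nu extL.
have [s As smax] := hdot_max (1, a *: u) cA A0.
have [p [extp pE _]] :=
  hdot_lexicographic_max_ext (1, a *: u) cA As smax.
have [_ [q Aq q0]] := sup_fst_attained cA A0 sup0.
have Ap : A p by case: extp.
exists p; last first.
  rewrite affine_hdot pE; apply: ge_sup; first by exists (s.1 + a * dot s.2 u), s.
  by move=> _ [r Ar <-]; rewrite affine_hdot; exact: smax.
apply: extL; split => //.
have dotM r : A r -> `|dot r.2 u| <= M * `|u|.
  move=> Ar; apply: le_trans (normr_dot_le _ _) _; apply: ler_wpM2r => //.
  exact: le_trans (snd_norm_le _) (AM _ Ar).
have := smax _ Aq; rewrite -pE -!affine_hdot q0.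
have := dotM _ Ap; have := dotM _ Aq; rewrite !ler_norml.
move=> /andP[ql qr] /andP[pl pr]; nra.
Qed.

Lemma clco_add_bounded (L : set RH) z M : (forall p, L p -> `|p| <= M) ->
  forall p, clco_add L z p -> `|p| <= M + `|z|.
Proof.
move=> LM _ [c Cc <-]; apply: le_trans (ler_normD _ _) _.
by rewrite lerD2r; exact: closure_conv_hull_bounded Cc.
Qed.

Lemma convex_clco_add (L : set RH) z : convex_set (clco_add L z).
Proof. exact/convex_translate/convex_closure/convex_conv_hull. Qed.

Lemma sub_clco_add (L : set RH) z p : L p -> clco_add L z (p + z).
Proof.
by move=> Lp; exists p => //; apply: subset_closure; exact: sub_gen_smallest.
Qed.

(** The model along [- p.2] equals [q.1 * (1 + b * p.1) - b * hdot p (q + z)] with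
    [b = a * l], where [q] attains the maximum; the first term is nonpositive
    for small [b], and the variational inequality for [p] bounds the second. *)
Lemma model_decrease A B (L : set RH) z p (a l nu th M : R) :
    weakly_compact A -> A !=set0 -> sup [set p.1 | p in A] = 0 ->
    weakly_compact B -> B z -> z.1 = 0 ->
    (forall p, A p -> `|p| <= M) -> `|z| <= M ->
    [set p | ext A p /\ - nu <= p.1] `<=` L -> L `<=` A ->
    argmin hnorm (clco_add L z) p -> th <= hnorm p ^+ 2 ->
    0 <= a -> 0 <= l -> a * l * (2 * M) <= 1 -> a * l * (4 * M ^+ 2) <= nu ->
  hypo dot A a (- (l *: p.2)) + hyper dot B a (- (l *: p.2)) <= - (a * l * th).
Proof.
move=> cA A0 sup0 cB Bz z0 AM zM extL LA pmin thp a0 l0 al1 alnu.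
have M0 : 0 <= M by exact: le_trans zM.
have pM : `|p| <= 2 * M.
  have [Cp _] := pmin.
  have := @clco_add_bounded _ z M (fun q Lq => AM q (LA q Lq)) p Cp; lra.
have normE : `|- (l *: p.2)| = l * `|p.2| by rewrite normrN normrZ ger0_norm.
have al0 : 0 <= a * l by exact: mulr_ge0.
have [||q Lq hypoq] :=
  @hypo_le_truncation A L a nu M (- (l *: p.2)) cA A0 sup0 AM a0.
- rewrite normE; have := le_trans (snd_norm_le p) pM.
  move=> p2M; have : a * l * M * `|p.2| <= a * l * M * (2 * M).
    by apply: ler_wpM2l => //; exact: mulr_ge0.
  nra.
- exact: extL.
have hyperz := hyper_le a (- (l *: p.2)) cB Bz.
have [q0 _] := sup_fst_attained cA A0 sup0.
have {q0} q0 := q0 _ (LA _ Lq).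
have pq := argmin_hnorm_variational (@convex_clco_add L z) pmin (sub_clco_add z Lq).
have {thp} : th <= p.1 * (q.1 + 0) + (dot q.2 p.2 + dot z.2 p.2).
  rewrite -z0 ![dot _ p.2]dotC -dotDr; apply: le_trans pq.
  by rewrite -hnorm_sqr.
have p1M : - (2 * M) <= p.1.
  by have := le_trans (fst_norm_le p) pM; rewrite ler_norml => /andP[].
move: hypoq hyperz; rewrite z0 !dotNr !dotZr => hypoq hyperz thpq.
have : a * l * th <= a * l * (p.1 * (q.1 + 0) + (dot q.2 p.2 + dot z.2 p.2)).
  exact: ler_wpM2l.
have : q.1 * (1 + a * l * p.1) <= 0.
  rewrite mulr_le0_ge0 //.
  have : a * l * - (2 * M) <= a * l * p.1 by exact: ler_wpM2l.
  lra.
lra.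
Qed.

(** With an approximate projection [p] of the origin on [clco_add L (0, w)], the
    inequality [hdot p (c + (0, w)) >= hdot p p - e / 2] persists when [(0, w)]
    is replaced by an extreme [z] of first coordinate 0 with a larger
    [hdot p z]; then [|q - p|^2 >= 0] bounds the norm of [q = c + z] below. *)
Lemma ext_far_from_origin B (L : set RH) w (th e M : R) :
    weakly_compact B -> B !=set0 -> inf [set p.1 | p in B] = 0 -> B (0, w) ->
    L !=set0 -> (forall p, L p -> `|p| <= M) -> 0 < e ->
    (forall q, clco_add L (0, w) q -> th <= hnorm q ^+ 2) ->
  exists2 z, ext B z /\ z.1 = 0 &
             forall q, clco_add L z q -> th - e <= hnorm q ^+ 2.
Proof.
move=> cB B0 inf0 Bw [l Ll] LM e0 thL.
have CM := closure_conv_hull_bounded LM.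
have [|||p Cp pmin] := @approximate_projection (clco_add L (0, w))
  (2 * ((2 * M) * (2 * M))) (e / 2) (@convex_clco_add L (0, w)).
- by exists (l + (0, w)); exact: sub_clco_add.
- move=> _ _ [c Cc <-] [d Cd <-].
  rewrite opprD addrACA subrr addr0; apply: le_trans (hdot_le_normM _ _) _.
  have dc : `|d - c| <= 2 * M.
    by apply: le_trans (ler_normB _ _) _; have := CM _ Cc; have := CM _ Cd; lra.
  by have := normr_ge0 (d - c); nra.
- lra.
have [B_ge0 _] := inf_fst_attained cB B0 inf0.
have [r Br|z [extz zE pz]] := @hdot_lexicographic_max_ext B (-1, 0) p (0, w) cB Bw.
  by have := B_ge0 _ Br; rewrite !hdot_fst /=; lra.
exists z; first by split=> //; move: zE; rewrite !hdot_fst /=; lra.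
move=> _ [c Cc <-].
have := pmin _ (ex_intro2 _ _ c Cc erefl).
have := thL _ Cp.
rewrite !hnorm_sqr; rewrite hdotDr => thp pc.
have := hdot_ge0 (c + z - p).
rewrite hdotBr ![hdot (c + z - p) _]hdotC !hdotBr hdotDr.
rewrite [hdot (c + z) p]hdotC hdotDr.
lra.
Qed.

(** * Descent *)

Lemma mcd_step_le (U : set H) (f : H -> R) (L N : set RH) (alphastar : \bar R)
    u u' : mcd_step dot U f L N alphastar u u' ->
  [/\ U u', N !=set0 & forall z, N z ->
    exists2 p, argmin hnorm (clco_add L z) p &
      forall s : R, 0 <= s -> (s%:E <= alphastar)%E -> U (u - s *: p.2) ->
                f u' <= f (u - s *: p.2)].
Proof.
move=> [av [al [z0 [avP alP [Nz0 z0min] ->]]]]; split.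
- by have [[]] := alP _ Nz0.
- by exists z0.
- move=> z Nz; exists (av z); first exact: avP.
  move=> s s0 sa Us; apply: le_trans (z0min _ Nz) _.
  by have [_] := alP _ Nz; apply.
Qed.

(** The decrease [c] does not depend on the point [u] of [C]: the step length is
    limited by the common bound [M] of the codifferentials, by [nu], by
    [alphastar] and by the uniform error of the approximation. *)
Lemma sufficient_decrease (U C : set H) (f : H -> R) (dl du : H -> set RH)
    (M nu th : R) (alphastar : \bar R) :
    uniformly_approximates dot U f dl du C ->
    (forall u, C u ->
       is_codifferential dot f u (dl u) (du u) /\ normalized (dl u) (du u)) ->
    (forall u p, C u -> dl u p -> `|p| <= M) ->
    (forall u p, C u -> du u p -> `|p| <= M) ->
    0 < nu -> 0 < th -> (0 < alphastar)%E ->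
  exists2 c, 0 < c & forall u u' (L N : set RH) z, C u ->
    mcd_step dot U f L N alphastar u u' ->
    [set p | ext (dl u) p /\ - nu <= p.1] `<=` L -> L `<=` dl u ->
    N `<=` du u -> N z -> z.1 = 0 ->
    (forall q, clco_add L z q -> th <= hnorm q ^+ 2) ->
    f u' <= f u - c.
Proof.
move=> [CU [r r0 [ballU unif]]] Df dlM duM nu0 th0 alphastar0.
pose K := `|M| + 1; have K0 : 0 < K by rewrite /K; have := normr_ge0 M; lra.
have MK : M <= K by rewrite /K; have := ler_norm M; lra.
(* The elements of [clco_add L z] have norm at most [2 * K], so that the
   displacement [l *: p.2] has norm at most [r]. *)
pose l := r / (2 * K); have l0 : 0 < l by rewrite divr_gt0 // mulr_gt0.
have lE : l * (2 * K) = r by rewrite divfK // mulf_neq0 // gt_eqF.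
have e0 : 0 < l * th / 2 by rewrite divr_gt0 // mulr_gt0.
have [s0 s00 s0a] : exists2 s, 0 < s & (s%:E <= alphastar)%E.
  case: alphastar alphastar0 => [s|_|//]; last by exists 1; rewrite ?leey.
  by rewrite lte_fin => ?; exists s.
have : \forall a \near 0^'+, [/\ 0 < a, a < 1, a < r^-1 &
   a < nu / (2 * K * r) /\ a < s0 / l /\ forall dx x,
     closed_ball_ Num.norm 0 r dx -> C x -> `|eps dot f dl du a dx x| < l * th / 2].
  near=> a; split.
  - by near: a; exact: nbhs_right_gt.
  - by near: a; exact: nbhs_right_lt.
  - by near: a; apply: nbhs_right_lt; rewrite invr_gt0.
  - split; first by near: a; apply: nbhs_right_lt; rewrite divr_gt0 // !mulr_gt0.
    split; first by near: a; apply: nbhs_right_lt; rewrite divr_gt0.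
    by near: a; exact: unif.
move=> /filter_ex[a [a0 a1 ar [anu [als epsa]]]].
have {}ar : a * r < 1 by rewrite -ltr_pdivlMr // mul1r.
have {}anu : a * (2 * K * r) < nu by rewrite -ltr_pdivlMr // !mulr_gt0.
have {}als : a * l < s0 by rewrite -ltr_pdivlMr.
have al0 : 0 < a * l by exact: mulr_gt0.
exists (a * l * th / 2); first by rewrite divr_gt0 // mulr_gt0.
move=> u u' L N z Cu step extL Ldl Ndu Nz z0 thL.
have [_ _ /(_ z Nz)[p pmin best]] := mcd_step_le step.
have [[[A0 cA _] [B0 cB _] _ _] [sup0 inf0]] := Df _ Cu.
have dlK q : dl u q -> `|q| <= K by move=> /(dlM _ _ Cu)/le_trans; exact.
have zK : `|z| <= K by apply: le_trans MK; exact: duM Cu (Ndu _ Nz).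
have [Cp _] := pmin.
have dec : hypo dot (dl u) a (- (l *: p.2)) + hyper dot (du u) a (- (l *: p.2))
    <= - (a * l * th).
  apply: (@model_decrease _ _ L z p a l nu th K) => //; do ?exact: ltW.
  - exact: Ndu.
  - exact: thL.
  - by rewrite -mulrA lE ltW.
  - suff -> : a * l * (4 * K ^+ 2) = a * (2 * K * r) by exact: ltW.
    by rewrite -lE; clearbody l K; ring.
have lpr : `|l *: p.2| <= r.
  rewrite normrZ gtr0_norm // -lE ler_pM2l //; apply: le_trans (snd_norm_le _) _.
  by have := @clco_add_bounded L z K (fun q Lq => dlK q (Ldl q Lq)) p Cp; lra.
have alpr : `|a *: (l *: p.2)| <= r.
  by rewrite normrZ gtr0_norm //; have := normr_ge0 (l *: p.2); nra.
have Ustep : U (u - (a * l) *: p.2).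
  by apply: (ballU _ Cu); rewrite /closed_ball_ /= opprB addrC subrK -scalerA.
have : f u' <= f (u - (a * l) *: p.2).
  by apply: best => //; [exact: ltW|apply: le_trans s0a; rewrite lee_fin ltW].
have := epsa (- (l *: p.2)) u _ Cu; rewrite /closed_ball_ /= sub0r opprK => /(_ lpr).
rewrite /eps /residual scalerN scalerA ltr_norml => /andP[_].
rewrite -(ltr_pM2l a0) mulrA mulfV ?gt_eqF // mul1r.
by move: dec; set h := hypo _ _ _ _; set k := hyper _ _ _ _; lra.
Unshelve. all: by end_near. Qed.

Lemma uniformly_approximatesS (U C C' : set H) (f : H -> R)
    (dl du : H -> set RH) : C' `<=` C ->
  uniformly_approximates dot U f dl du C -> uniformly_approximates dot U f dl du C'.
Proof.
move=> C'C [CU [r r0 [ballU unif]]]; split; first exact: subset_trans CU.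
exists r => //; split=> [u /C'C|e e0]; first exact: ballU.
by near=> a => dx u dxr /C'C Cu; move: dx u dxr Cu; near: a; exact: unif.
Unshelve. all: by end_near. Qed.

Lemma omega_ge0 dlt (du : H -> set RH) u nu : weakly_compact (du u) ->
    du u !=set0 -> inf [set p.1 | p in du u] = 0 ->
  (0 <= omega dot dlt du u nu)%E.
Proof.
move=> cB B0 inf0; have [_ [[b w] Bw /= b0]] := inf_fst_attained cB B0 inf0.
apply: le_ereal_sup_tmp.
exists (ereal_inf [set (hnorm q ^+ 2)%:E | q in clco_add (dlt nu u) (0, w)]).
  by exists w => //=; rewrite -b0.
by apply: le_ereal_inf_tmp => _ [q _ <-]; rewrite lee_fin sqr_ge0.
Qed.

(** By continuity of the norm, a point of the closure can be traded for one of
    [A] itself. *)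
Lemma hdist0_closure_conv_hull (A L : set RH) p (e : R) : convex_set A ->
    L `<=` A -> closure (conv_hull L) p -> hnorm p < e ->
  (hdist0 dot A <= e%:E)%E.
Proof.
move=> cA LA clp pe.
have [|q [/(smallest_sub cA LA) Aq qe]] := clp [set q | hnorm q < e].
  by apply: (cvgr_lt _ (@continuous_hnorm p)).
by apply: ge_ereal_inf; exists (hnorm q)%:E; [exists q|rewrite lee_fin ltW].
Qed.

End HilbertSpace.

(** * Limits of sequences *)

Lemma nonincreasing_small_decrease (R : realType) (u : nat -> R) (c : R) :
  nonincreasing_seq u -> has_lbound (range u) -> 0 < c ->
  \forall n \near \oo, u n - c < u n.+1.
Proof.
move=> u_dec u_lb c0; have /cvg_ex[l ul] := nonincreasing_is_cvgn u_dec u_lb.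
have lu n : l <= u n.
  by have := nonincreasing_cvgn_ge u_dec (cvgP l ul) n; rewrite (cvg_lim _ ul).
near=> n.
have : u n < l + c.
  near: n; apply: (cvgr_lt _ ul); lra.
by have := lu n.+1; lra.
Unshelve. all: by end_near. Qed.

Lemma near_lt_limn_einf (R : realType) (u : nat -> \bar R) (a : \bar R) :
  (a < limn_einf u)%E -> \forall n \near \oo, (a <= u n)%E.
Proof.
rewrite limn_einf_lim (cvg_lim _ (@cvg_einfs_sup R u)) //.
move=> /ereal_sup_gt[_ [n _ <-] an]; exists n => // k /= nk.
by apply: le_trans (ltW an) _; apply: ereal_inf_lbound; exists k.
Qed.

Lemma cvge0_le (R : realType) (u : nat -> \bar R) :
  (forall n, 0 <= u n)%E ->
  (forall e : R, 0 < e -> \forall n \near \oo, (u n <= e%:E)%E) ->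
  u n @[n --> \oo] --> (0%R)%:E.
Proof.
move=> u0 ue; apply/fine_cvgP; split.
  near=> n; rewrite ge0_fin_numE //; apply: le_lt_trans (ltry 1).
  by near: n; exact: ue.
apply/cvgr0Pnorm_le => e e0; near=> n.
rewrite /= ger0_norm ?fine_ge0 // -lee_fin fineK; first by near: n; exact: ue.
rewrite ge0_fin_numE //; apply: le_lt_trans (ltry e).
by near: n; exact: ue.
Unshelve. all: by end_near. Qed.

Theorem theorem4 (R : realType) (H : completeNormedModType R)
    (dot : {dot H for idfun})
    (norm_dot : forall x : H, `|x| ^+ 2 = dot x x)
    (U : set H) (openU : open U)
    (f : H -> R) (dl du : H -> set (RxH R H))
    (Df : forall x, U x ->
       is_codifferential dot f x (dl x) (du x) /\ normalized (dl x) (du x))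
    (dlt dut : \bar R -> H -> set (RxH R H))
    (dltP : is_lower_truncation U dl dlt)
    (dutP : is_upper_truncation U du dut)
    (f_bounded_below : has_lbound (f @` U))
    (nu mu : nat -> \bar R)
    (nu_ge0 : forall n, (0 <= nu n)%E) (mu_ge0 : forall n, (0 <= mu n)%E)
    (alphastar : \bar R) (alphastar_gt0 : (0 < alphastar)%E)
    (x : nat -> H) (x0U : U (x 0%N))
    (mcd : forall n, mcd_step dot U f (dlt (nu n) (x n)) (dut (mu n) (x n))
                       alphastar (x n) (x n.+1))
    (dl_bounded : bounded_set (\bigcup_n dl (x n)))
    (du_bounded : bounded_set (\bigcup_n du (x n)))
    (nustar : \bar R) (liminf_nu : limn_einf nu = nustar)
    (nustar_gt0 : (0 < nustar)%E)
    (balls : exists2 r : R, 0 < r &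
       forall n, closed_ball_ Num.norm (x n) r `<=` U)
    (approx :
       (exists m : nat,
          uniformly_approximates dot U f dl du [set x n | n in [set n | (m <= n)%N]])
       \/ uniformly_approximates dot U f dl du [set y | U y /\ f y <= f (x 0%N)]) :
  (omega dot dlt du (x n) (nu n) @[n --> \oo] --> (0%R)%:E) /\
  ((forall y, U y -> du y = [set (0 : RxH R H)]) ->
   (forall n, nu n = +oo%E) ->
   hdist0 dot (dl (x n)) @[n --> \oo] --> (0%R)%:E).
Proof.
have xU n : U (x n) by elim: n => // n _; have [] := mcd_step_le (mcd n).
have f_dec : nonincreasing_seq (f \o x).
  apply/nonincreasing_seqP => n /=.
  have [_ [z Nz] /(_ z Nz)[p _]] := mcd_step_le (mcd n).
  move=> /(_ 0 (lexx _) (ltW alphastar_gt0)); rewrite scale0r subr0; apply.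
  exact: xU.
have [m unif] : exists m : nat,
    uniformly_approximates dot U f dl du [set x n | n in [set n | (m <= n)%N]].
  case: approx => [//|unif]; exists 0%N; apply: uniformly_approximatesS unif.
  by move=> _ [n _ <-]; split => //; exact: (f_dec 0%N n).
have [Ml _ dlM] := ex_strict_bound_gt0 dl_bounded.
have [Mu _ duM] := ex_strict_bound_gt0 du_bounded.
pose M := Num.max Ml Mu.
have dlMx n p : dl (x n) p -> `|p| <= M.
  by move=> dlp; rewrite le_max ltW //; apply: dlM; exists n.
have duMx n p : du (x n) p -> `|p| <= M.
  by move=> dup; rewrite le_max orbC ltW //; apply: duM; exists n.
have [nu0 nu0_gt0 nu0_lt] : exists2 s : R, 0 < s & (s%:E < limn_einf nu)%E.
  rewrite liminf_nu; case: (nustar) nustar_gt0 => [s|_|//].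
    by rewrite lte_fin => s0; exists (s / 2); rewrite ?lte_fin; lra.
  by exists 1; rewrite ?ltry.
have nu_ge := near_lt_limn_einf nu0_lt.
have omega_small (e : R) : 0 < e ->
    \forall n \near \oo, (omega dot dlt du (x n) (nu n) <= e%:E)%E.
  move=> e0; have e2 : 0 < e / 2 by lra.
  have [|||c c0 dec] := sufficient_decrease (M := M) norm_dot unif _ _ _
    nu0_gt0 e2 alphastar_gt0.
  - by move=> _ [n _ <-]; exact: Df.
  - by move=> _ p [n _ <-]; exact: dlMx.
  - by move=> _ p [n _ <-]; exact: duMx.
  have f_lb : has_lbound (range (f \o x)).
    by have [b fb] := f_bounded_below; exists b => _ [n _ <-]; apply: fb; exists (x n).
  near=> n.
  have mn : (m <= n)%N by near: n; exact: nbhs_infty_ge.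
  have nun : (nu0%:E <= nu n)%E by near: n.
  have fn : f (x n) - c < f (x n.+1).
    by near: n; exact: nonincreasing_small_decrease f_dec f_lb c0.
  have [[[A0 cA _] [B0 cB _] _ _] [sup0 inf0]] := Df _ (xU n).
  have [extL Ldl] := dltP _ _ (nu_ge0 n) (xU n).
  have [extN Ndu] := dutP _ _ (mu_ge0 n) (xU n).
  have {}extL : [set p | ext (dl (x n)) p /\ - nu0 <= p.1] `<=` dlt (nu n) (x n).
    move=> p [extp p1]; apply: extL; split => //.
    apply: (@le_trans _ _ (- nu0%:E)%E); last by rewrite lee_fin.
    by rewrite leeN2.
  (* The zero functional is also maximized at a point of the truncation. *)
  have L0 : dlt (nu n) (x n) !=set0.
    have [||p Lp _] := hypo_le_truncation (a := 0) (u := 0) norm_dot cA A0 sup0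
      (@dlMx n) _ _ extL => //; last by exists p.
    by rewrite mul0r mulr0 ltW.
  apply: ge_ereal_sup => _ [w Bw <-]; rewrite leNgt; apply/negP => far.
  have {}far q : clco_add (dlt (nu n) (x n)) (0, w) q -> e <= hnorm dot q ^+ 2.
    move=> Cq; rewrite -lee_fin; apply: le_trans (ltW far) _.
    by apply: ereal_inf_lbound; exists q.
  have [p Lp|z [extz z0] zfar] := ext_far_from_origin norm_dot cB B0 inf0 Bw L0
    (M := M) _ e2 far.
    exact: dlMx (Ldl _ Lp).
  suff : f (x n.+1) <= f (x n) - c by lra.
  apply: (dec (x n) _ _ _ z _ (mcd n)) => //; first by exists n.
    by apply: extN; split => //; rewrite z0.
  by move=> q /zfar; lra.
have omega_cvg : omega dot dlt du (x n) (nu n) @[n --> \oo] --> (0%R)%:E.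
  apply: cvge0_le omega_small => n.
  have [[_ [B0 cB _] _ _] [_ inf0]] := Df _ (xU n).
  exact: omega_ge0.
split => // du0 nuy; apply: cvge0_le.
  by move=> n; apply: le_ereal_inf_tmp => _ [p _ <-]; rewrite lee_fin sqrtr_ge0.
move=> e e0; have e2 : 0 < e ^+ 2 / 2 by rewrite divr_gt0 // exprn_gt0.
have := omega_small _ e2; apply: filterS => n omega_le.
have : (ereal_inf [set (hnorm dot q ^+ 2)%:E
                   | q in clco_add (dlt (nu n) (x n)) (0 : RxH R H)%R]
    < (e ^+ 2)%:E)%E.
  apply: (@le_lt_trans _ _ (e ^+ 2 / 2)%:E); last by rewrite lte_fin; lra.
  apply: le_trans omega_le; apply: ereal_sup_ubound; exists 0 => //=.
  by rewrite du0.
move=> /ereal_inf_lt[_ [_ [p clp <-] <-]]; rewrite lte_fin addr0 => pe.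
have [[[_ _ cvxA] _ _ _] _] := Df _ (xU n).
have [_ Ldl] := dltP _ _ (nu_ge0 n) (xU n).
apply: (hdist0_closure_conv_hull norm_dot cvxA Ldl clp).
by rewrite -(@ltr_pXn2r _ 2) ?nnegrE ?sqrtr_ge0 ?ltW.
Unshelve. all: by end_near. Qed.
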